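(* Let $X$ be a transitive subshift of finite type. Then the set of roof functions $r\colon X\to(0,\infty)$ satisfying the Walters property for which the suspension flow over $(X,\sigma)$ with roof function $r$ is topologically mixing is a dense $G_\delta$ subset of the set of all roof functions $X\to(0,\infty)$ satisfying the Walters property, with respect to the topology induced by the norm $\|\cdot\|_{\mathrm{Wal}}$.
   Context: Let $A$ be a finite alphabet. $A^{\mathbb{Z}}$ has the metric $d(x,y)=2^{-\min\{|n|: x_n\neq y_n\}}$ (and $d(x,x)=0$), and $\sigma$ is the left shift $(\sigma x)_n=x_{n+1}$. A shift space is a nonempty closed $\sigma$-invariant ($\sigma(X)=X$) set $X\subset A^{\mathbb{Z}}$; it is a subshift of finite type if it is the set of sequences avoiding some finite set of forbidden words. For $x \in A^{\mathbb Z}$, $x_{[i,j]}=x_i\cdots x_j$. The language $\mathcal{L}$ of $X$ is the set of all finite words appearing in some $x\in X$. $X$ is transitive if for all $u,v\in\mathcal{L}$ there is $w\in\mathcal{L}$ with $uwv\in\mathcal{L}$. A function $r\colon X\to\mathbb{R}$ satisfies the Walters property if for every $\varepsilon>0$ there is $k\ge 0$ such that for all $n\in\mathbb{N}$ and all $x,y\in X$ with $x_{[-k,n+k]}=y_{[-k,n+k]}$ we have $\left|\sum_{j=0}^{n-1}\big(r(\sigma^jx)-r(\sigma^jy)\big)\right|<\varepsilon$. On the space of functions with the Walters property one uses the norm $$\|r\|_{\mathrm{Wal}}=2\|r\|_\infty+\sup_{m\ge1}\ \max_{d(x,y)<2^{-m}}\left|\sum_{j=0}^{m-1}\big(r(\sigma^jx)-r(\sigma^jy)\big)\right|.$$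 Suspension flow: given $r\colon X\to(0,\infty)$, let $M_r=\{(x,t)\in X\times[0,\infty): 0\le t\le r(x)\}/\sim$, with the quotient topology, where $(x,r(x))\sim(\sigma x,0)$. The suspension flow is $\varphi^T(x,s)=(\sigma^n x,s')$, where $n$ and $s'$ satisfy $\sum_{j=0}^{n-1}r(\sigma^jx)+s'=T+s$ and $0\le s'\le r(\sigma^nx)$. It is topologically mixing if for all nonempty open $U,V\subset M_r$ there is $T\in\mathbb{R}$ such that $\varphi^t(U)\cap V\neq\emptyset$ for all $t\ge T$.
   Formalization: X is additionally assumed to be infinite; a finite transitive subshift of finite type is a single periodic orbit, whose suspension flow is a circle rotation and never mixing, so density fails there. *)

(* Defs.v *)
From HB Require Import structures.
From Stdlib Require Import Relations.Relation_Operators.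
From mathcomp Require Import all_boot all_order all_algebra.
From mathcomp Require Import generic_quotient.
From mathcomp Require Import all_classical all_reals all_analysis borel_hierarchy.
From mathcomp Require Import zify ring lra.

Set Implicit Arguments.
Unset Strict Implicit.
Unset Printing Implicit Defensive.

Import Order.TTheory GRing.Theory Num.Theory.
Import numFieldNormedType.Exports.

Local Open Scope classical_set_scope.
Local Open Scope ring_scope.
Local Open Scope quotient_scope.

(* The field R of values of the metric is a parameter of the type so that the
   metric structure can be inferred from the type. *)
Definition fullshift (R : realType) (A : finType) : Type := int -> A.

Section FullShift.
Context {R : realType} {A : finType}.
Implicit Types x y z : fullshift R A.

HB.instance Definition _ := Choice.copy (fullshift R A) (int -> A).

Definition differ_at x y : pred nat :=
  fun m => (x m%:Z != y m%:Z) || (x (- m%:Z) != y (- m%:Z)).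

(* The exponent is min {|n| : x_n <> y_n}. *)
Definition dist x y : R :=
  match pselect (exists m, differ_at x y m) with
  | left h => 2 ^- ex_minn h
  | right _ => 0
  end.

Lemma differ_atP x y (m : nat) :
  reflect (exists2 n : int, absz n = m & x n <> y n) (differ_at x y m).
Proof.
apply: (iffP orP) => [[] /eqP h|[[n|n] <- /= /eqP h]].
- by exists m%:Z.
- by exists (- m%:Z) => //; rewrite abszN.
- by left.
- by right; rewrite -NegzE.
Qed.

Lemma dist_ge0 x y : 0 <= dist x y.
Proof. by rewrite /dist; case: pselect => // h; rewrite invr_ge0 exprn_ge0. Qed.

Lemma dist_ltP x y (m : nat) :
  reflect (forall i : int, (absz i <= m)%N -> x i = y i) (dist x y < 2 ^- m).
Proof.
rewrite /dist; case: pselect => h.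
  rewrite ltf_pV2 ?posrE ?exprn_gt0// ltr_eXn2l ?ltr1n//.
  case: ex_minnP => k kxy kmin; apply: (iffP idP).
    move=> mk i im; apply: contrapT => xy.
    have /kmin : differ_at x y (absz i) by apply/differ_atP; exists i.
    by rewrite leqNgt (leq_ltn_trans im mk).
  move=> e; have /differ_atP[n nk nxy] := kxy; rewrite ltnNge; apply/negP => km.
  by apply: nxy; apply: e; rewrite nk.
apply: (iffP idP) => [_ i im|_]; last by rewrite invr_gt0 exprn_gt0.
apply: contrapT => xy; apply: h; exists (absz i).
by apply/differ_atP; exists i.
Qed.

Lemma dist_eq x y : (forall m, dist x y < 2 ^- m) -> x = y.
Proof.
move=> h; apply/funext => i.
by have /dist_ltP := h (absz i); apply.
Qed.

Lemma distxx x : dist x x = 0.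
Proof.
rewrite /dist; case: pselect => // h; exfalso.
by have [m /differ_atP[n _]] := h.
Qed.

Lemma dist_positivity x y : dist x y = 0 -> x = y.
Proof. by move=> e; apply: dist_eq => m; rewrite e invr_gt0 exprn_gt0. Qed.

Lemma dist_pow x y : dist x y != 0 -> exists m : nat, dist x y = 2 ^- m.
Proof.
rewrite /dist; case: pselect => [h _|_]; last by rewrite eqxx.
by exists (ex_minn h).
Qed.

Lemma dist_sym x y : dist x y = dist y x.
Proof.
suff le a b : dist a b <= dist b a by apply/eqP; rewrite eq_le !le.
have [-> |/dist_pow[m e]] := eqVneq (dist a b) 0; first exact: dist_ge0.
rewrite e leNgt; apply/negP => /dist_ltP h.
suff : dist a b < 2 ^- m by rewrite e ltxx.
by apply/dist_ltP => i im; rewrite h.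
Qed.

Lemma dist_triangle y x z : dist x z <= dist x y + dist y z.
Proof.
have [-> |/dist_pow[m e]] := eqVneq (dist x z) 0.
  by rewrite addr_ge0 ?dist_ge0.
rewrite leNgt; apply/negP => h.
suff : dist x z < 2 ^- m by rewrite e ltxx.
have /dist_ltP xy : dist x y < 2 ^- m.
  by rewrite -e; apply: le_lt_trans h; rewrite lerDl dist_ge0.
have /dist_ltP yz : dist y z < 2 ^- m.
  by rewrite -e; apply: le_lt_trans h; rewrite lerDr dist_ge0.
by apply/dist_ltP => i im; rewrite xy// yz.
Qed.

HB.instance Definition _ := isMetric.Build R (fullshift R A)
  distxx dist_positivity dist_sym dist_triangle.

Definition shift x : fullshift R A := fun i => x (i + 1).
Definition shiftz (n : int) x : fullshift R A := fun i => x (i + n).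

(* The word x_{[i, i + l - 1]}. *)
Definition block x (i : int) (l : nat) : seq A :=
  [seq x (i + j%:Z) | j <- iota 0 l].

Definition occurs (w : seq A) x := exists i : int, block x i (size w) = w.

Lemma iter_shift n x : iter n shift x = shiftz n%:Z x.
Proof.
elim: n => [|n IH]; apply/funext => i; first by rewrite /shiftz addr0.
by rewrite iterS IH /shift /shiftz -addrA -PoszD add1n.
Qed.

End FullShift.

Record shift_space (R : realType) (A : finType) := ShiftSpace {
  ss_set :> set (fullshift R A) ;
  ss_nonempty : ss_set !=set0 ;
  ss_closed : closed ss_set ;
  ss_invariant : shift @` ss_set = ss_set }.

Section ShiftSpace.
Context {R : realType} {A : finType}.
Implicit Type X : shift_space R A.

Definition language X : set (seq A) :=
  [set w | exists2 x, ss_set X x & occurs w x].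

Definition transitive_shift X := forall u v, language X u -> language X v ->
  exists2 w, language X w & language X (u ++ w ++ v).

Definition subshift_finite_type X := exists F : seq (seq A),
  X = [set x | forall w, w \in F -> ~ occurs w x] :> set (fullshift R A).

Lemma ss_shift X x : ss_set X x -> ss_set X (shift x).
Proof. by move=> Xx; rewrite -ss_invariant; exists x. Qed.

Lemma ss_shiftN1 X x : ss_set X x -> ss_set X (shiftz (-1) x).
Proof.
rewrite -{1}ss_invariant => -[y Xy <-].
by rewrite (_ : shiftz _ _ = y)//; apply/funext => i; rewrite /shiftz /shift subrK.
Qed.

Lemma ss_shiftz X n x : ss_set X x -> ss_set X (shiftz n x).
Proof.
move=> Xx; case: n => [n|n].
  by rewrite -iter_shift; elim: n => //= n; exact: ss_shift.
elim: n => [|n IH]; first exact: ss_shiftN1.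
rewrite (_ : shiftz _ _ = shiftz (-1) (shiftz (Negz n) x)); first exact: ss_shiftN1.
by apply/funext => i; rewrite /shiftz !NegzE -addrA -opprD -PoszD add1n.
Qed.

Definition sigmaz X (n : int) (x : X) : X :=
  SigSub (mem_set (ss_shiftz n (set_valP x))).

Definition sigma X (x : X) : X :=
  SigSub (mem_set (ss_shift (set_valP x))).

Lemma iter_sigma X n (x : X) : iter n (@sigma X) x = sigmaz n%:Z x.
Proof.
apply: val_inj => /=; rewrite -iter_shift.
by elim: n => //= n ->.
Qed.

Lemma sigmazD X m n (x : X) : sigmaz m (sigmaz n x) = sigmaz (m + n) x.
Proof. by apply: val_inj; apply/funext => i /=; rewrite /shiftz addrA. Qed.

Lemma sigmaz0 X (x : X) : sigmaz 0 x = x.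
Proof. by apply: val_inj; apply/funext => i /=; rewrite /shiftz addr0. Qed.

Lemma sigmaz1 X (x : X) : sigmaz 1 x = sigma x.
Proof. by apply: val_inj. Qed.

Lemma fullshift_compact : compact [set: fullshift R A].
Proof.
pose P := prod_topology (fun _ : int => discrete_topology A).
have cP : compact [set: P].
  have := @tychonoff int (fun=> discrete_topology A) (fun=> setT).
  rewrite (_ : [set f | _] = setT); last by apply/seteqP; split.
  by apply=> i; apply: finite_compact; exact: finite_finset.
pose f : P -> fullshift R A := id.
rewrite (_ : setT = f @` setT); last first.
  by apply/seteqP; split => // x _; exists x.
apply: continuous_compact cP; apply: continuous_subspaceT => x U.
rewrite -nbhs_ballE => -[e /= e0 eU].
have [m _ me] : exists2 m, True & 2 ^- m < e.
  have /cvgrPdist_lt/(_ _ e0)[m _ /(_ m (leqnn m))] :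
      (fun n => 2^-1 ^+ n : R) @ \oo --> 0.
    by apply: cvg_expr; rewrite ger0_norm ?invr_ge0// invf_lt1 ?ltr1n.
  rewrite /= sub0r normrN ger0_norm ?exprn_ge0 ?invr_ge0// exprVn => h.
  by exists m.
have coord i : \forall y \near (x : P), (y : P) i = (x : P) i.
  have := @proj_continuous int (fun=> discrete_topology A) i x.
  move=> /(_ [set a | a = x i]); apply.
  by rewrite nbhs_principalE; apply/principal_filterP.
have agree n : \forall y \near (x : P),
    forall i : int, (absz i <= n)%N -> (x : P) i = (y : P) i.
  elim: n => [|n IH].
    by apply: filterS (coord 0) => y h i; rewrite leqn0 absz_eq0 => /eqP ->.
  apply: filterS3 IH (coord n.+1%:Z) (coord (- n.+1%:Z)) => y h1 h2 h3 i.
  rewrite leq_eqVlt ltnS => /orP[/eqP|]; last exact: h1.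
  by case: i => k /= [->]; rewrite ?NegzE ?h2 ?h3.
apply: filterS (agree m) => y h; apply: eU; rewrite ballEmdist.
by apply: lt_trans me; apply/dist_ltP.
Qed.

Lemma compact_shift_space X : compact [set: X].
Proof.
have cX : compact (X : set _).
  by apply: subclosed_compact (@ss_closed _ _ X) fullshift_compact _.
move=> F PF _.
have PG : ProperFilter (set_val @ F : set_system (fullshift R A)).
  exact: fmap_proper_filter.
have GX : (set_val @ F) (X : set (fullshift R A)).
  have FT : F setT by exact: filterT.
  by apply: (@filterS _ F _ setT) => // x _; exact: (set_valP x).
have [p [Xp cp]] := cX _ PG GX.
exists (SigSub (mem_set Xp)); split => // U V FU [_ [ [W oW <-] Wp WV] ].
have GU : (set_val @ F) (set_val @` U : set (fullshift R A)).
  by apply: (@filterS _ F _ U) => // x Ux; exists x.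
have [_ [ [x Ux <-] Wx] ] := cp _ W GU (open_nbhs_nbhs (conj oW Wp)).
by exists x; split => //; exact: WV.
Qed.

Definition walters_property X (r : X -> R) :=
  forall e : R, 0 < e -> exists k : nat, forall (n : nat) (x y : X),
    block (\val x) (- k%:Z) (n + k.*2).+1 = block (\val y) (- k%:Z) (n + k.*2).+1 ->
    `| \sum_(j < n) (r (iter j (@sigma X) x) - r (iter j (@sigma X) y)) | < e.

Definition sup_norm X (r : X -> R) : R := sup (range (fun x => `|r x|)).

Definition variation X (r : X -> R) (m : nat) : R :=
  sup [set `| \sum_(j < m) (r (iter j (@sigma X) xy.1)
                            - r (iter j (@sigma X) xy.2)) |
      | xy in [set xy : X * X | mdist (\val xy.1) (\val xy.2) < 2 ^- m]].

(* All suprema are suprema of bounded sets when r has the Walters property;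
   see walters_bounded and walters_variation_bounded. *)
Definition walters_norm X (r : X -> R) : R :=
  2 * sup_norm r + sup [set variation r m | m in [set m | (1 <= m)%N]].

Definition walters X : {pred X -> R} := fun r => `[< walters_property r >].

Lemma block_eqP (x y : fullshift R A) i l :
  (forall j : nat, (j < l)%N -> x (i + j%:Z) = y (i + j%:Z)) <->
  block x i l = block y i l.
Proof.
split=> [h|h j jl].
  by apply/eq_in_map => j; rewrite mem_iota add0n => /andP[_]; exact: h.
have := congr1 (fun s => nth (x i) s j) h.
by rewrite !(nth_map 0%N) ?size_iota// nth_iota// add0n.
Qed.

Lemma walters_dist X (r : X -> R) : walters_property r ->
  forall e : R, 0 < e -> exists k : nat, forall (n : nat) (x y : X),
    mdist (\val x) (\val y) < 2 ^- (n + k) ->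
    `| \sum_(j < n) (r (iter j (@sigma X) x) - r (iter j (@sigma X) y)) | < e.
Proof.
move=> wr e e0; have [k hk] := wr e e0; exists k => n x y /dist_ltP xy.
apply: hk; apply/block_eqP => j jl; apply: xy.
lia.
Qed.

Lemma walters_continuous X (r : X -> R) : walters_property r -> continuous r.
Proof.
move=> wr x.
apply/(@cvgrPdist_lt _ _ _ (nbhs x) (nbhs_filter x)) => e e0.
have [k hk] := walters_dist wr e0.
have bx : nbhs (\val x) [set y | mdist (\val x) y < 2 ^- (1 + k)].
  have := @nbhsx_ballx R (fullshift R A) (\val x) (2 ^- (1 + k)).
  by rewrite ballEmdist; apply; rewrite invr_gt0 exprn_gt0.
have bx' : nbhs x (set_val @^-1` [set y | mdist (\val x) y < 2 ^- (1 + k)]).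
  exact: initial_continuous bx.
have xk (y : X) : mdist (\val x) (\val y) < 2 ^- (1 + k) -> `|r x - r y| < e.
  by move=> /hk; rewrite big_ord1.
exact: (@filterS X (nbhs x) (nbhs_filter x) _ _ xk bx').
Qed.

Lemma shift_space_point X : exists x : X, True.
Proof. by have [x Xx] := ss_nonempty X; exists (SigSub (mem_set Xx)). Qed.

Lemma walters_bounded X (r : X -> R) : walters_property r ->
  exists M : R, forall x, `|r x| <= M.
Proof.
move=> /walters_continuous cr; have [x0 _] := shift_space_point X.
have [||c _ cmax] := @compact_EVT_max X R (fun x => `|r x|) setT _ (@compact_shift_space X).
- by exists x0.
- by apply: continuous_subspaceT => x; apply: continuous_comp; [exact: cr|exact: norm_continuous].
- by exists `|r c| => x; apply: cmax; rewrite inE.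
Qed.

Lemma walters_pos_lbound X (r : X -> R) : walters_property r ->
  (forall x, 0 < r x) -> exists2 c : R, 0 < c & forall x, c <= r x.
Proof.
move=> /walters_continuous cr r0; have [x0 _] := shift_space_point X.
have [||c _ cmin] := @compact_EVT_min X R r setT _ (@compact_shift_space X).
- by exists x0.
- by apply: continuous_subspaceT => x; exact: cr.
- by exists (r c) => // x; apply: cmin; rewrite inE.
Qed.

Lemma sup_norm_ub X (r : X -> R) x : walters_property r -> `|r x| <= sup_norm r.
Proof.
move=> /walters_bounded[M rM]; apply: ub_le_sup; last by exists x.
by exists M => _ [y _ <-].
Qed.

Lemma sup_norm_le X (r : X -> R) M : (forall x, `|r x| <= M) -> sup_norm r <= M.
Proof.
move=> rM; have [x0 _] := shift_space_point X.
by apply: ge_sup; [exists `|r x0|, x0 | move=> _ [x _ <-]].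
Qed.

Lemma walters_variation_bounded X (r : X -> R) : walters_property r ->
  exists M : R, forall (m : nat) (x y : X), mdist (\val x) (\val y) < 2 ^- m ->
    `| \sum_(j < m) (r (iter j (@sigma X) x) - r (iter j (@sigma X) y)) | <= M.
Proof.
move=> wr; have [B rB] := walters_bounded wr.
have [k hk] := walters_dist wr ltr01.
have B0 : 0 <= B.
  by have [x0 _] := shift_space_point X; exact: le_trans (rB x0).
have tail (l : nat) (f g : nat -> X) :
    `| \sum_(j < l) (r (f j) - r (g j)) | <= (B + B) *+ l.
  rewrite (le_trans (ler_norm_sum _ _ _))//.
  rewrite -[l in leRHS]card_ord -sumr_const ler_sum// => j _.
  by rewrite (le_trans (ler_normB _ _))// lerD.
exists (1 + (B + B) *+ k) => m x y xy; case: (leqP k m) => [km|mk].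
  rewrite -(subnK km) big_split_ord/= (le_trans (ler_normD _ _))// lerD//.
    by apply/ltW/hk; rewrite subnK.
  exact: (tail _ (fun j => iter (m - k + j) _ x) (fun j => iter (m - k + j) _ y)).
rewrite (le_trans (tail _ (fun j => iter j _ x) (fun j => iter j _ y)))//.
rewrite -[leLHS]add0r lerD// -(subnK (ltnW mk)) mulrnDr lerDr.
by rewrite mulrn_wge0// addr_ge0.
Qed.

Lemma variation_ub X (r : X -> R) m (x y : X) : walters_property r ->
  (1 <= m)%N -> mdist (\val x) (\val y) < 2 ^- m ->
  `| \sum_(j < m) (r (iter j (@sigma X) x) - r (iter j (@sigma X) y)) |
    <= sup [set variation r m | m in [set m | (1 <= m)%N]].
Proof.
move=> wr m1 xy; have [M hM] := walters_variation_bounded wr.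
have [x0 _] := shift_space_point X.
apply: (@le_trans _ _ (variation r m)); apply: ub_le_sup.
- by exists M => _ [[a b] /= ab <-]; exact: hM.
- by exists (x, y).
- exists M => _ [l _ <-]; apply: ge_sup.
    exists 0, (x0, x0); first by rewrite /= metric_structure.mdistxx invr_gt0 exprn_gt0.
    by under eq_bigr do rewrite subrr; rewrite big1_eq normr0.
  by move=> _ [[a b] /= ab <-]; exact: hM.
- by exists m.
Qed.

Lemma variation_le X (r : X -> R) M :
  (forall (m : nat) (x y : X), (1 <= m)%N -> mdist (\val x) (\val y) < 2 ^- m ->
    `| \sum_(j < m) (r (iter j (@sigma X) x) - r (iter j (@sigma X) y)) | <= M) ->
  sup [set variation r m | m in [set m | (1 <= m)%N]] <= M.
Proof.
move=> hM; have [x0 _] := shift_space_point X.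
apply: ge_sup; first by exists (variation r 1), 1%N.
move=> _ [l l1 <-]; apply: ge_sup.
  exists 0, (x0, x0); first by rewrite /= metric_structure.mdistxx invr_gt0 exprn_gt0.
  by under eq_bigr do rewrite subrr; rewrite big1_eq normr0.
by move=> _ [[a b] /= ab <-]; exact: hM.
Qed.

Lemma walters_submod_closed X : submod_closed (@walters X).
Proof.
split.
  apply/asboolP => e e0; exists 0%N => n x y _.
  by rewrite big1 ?normr0// => j _; rewrite subrr.
move=> a f g /asboolP wf /asboolP wg; apply/asboolP => e e0.
have e1 : 0 < e / 2 / (`|a| + 1) by rewrite !divr_gt0// ltr_pwDr.
have e2 : 0 < e / 2 by rewrite divr_gt0.
have [k1 h1] := wf _ e1; have [k2 h2] := wg _ e2.
exists (maxn k1 k2) => n x y /block_eqP xy.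
have f1 : block (\val x) (- k1%:Z) (n + k1.*2).+1
        = block (\val y) (- k1%:Z) (n + k1.*2).+1.
  apply/block_eqP => j jl; have := xy (maxn k1 k2 - k1 + j)%N.
  rewrite (_ : - (maxn k1 k2)%:Z + (maxn k1 k2 - k1 + j)%N = - k1%:Z + j); last lia.
  by apply; lia.
have f2 : block (\val x) (- k2%:Z) (n + k2.*2).+1
        = block (\val y) (- k2%:Z) (n + k2.*2).+1.
  apply/block_eqP => j jl; have := xy (maxn k1 k2 - k2 + j)%N.
  rewrite (_ : - (maxn k1 k2)%:Z + (maxn k1 k2 - k2 + j)%N = - k2%:Z + j); last lia.
  by apply; lia.
under eq_bigr do rewrite /= opprD addrACA -scalerBr.
rewrite big_split/= -scaler_sumr (le_lt_trans (ler_normD _ _))//.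
rewrite [ltRHS]splitr ltr_leD//; last exact/ltW/h2.
rewrite normrM; apply: (@le_lt_trans _ _ (`|a| * (e / 2 / (`|a| + 1)))).
  by rewrite ler_wpM2l//; exact/ltW/h1.
rewrite mulrCA gtr_pMr// ltr_pdivrMr ?mul1r ?ltrDl//.
Qed.

HB.instance Definition _ X := GRing.isSubmodClosed.Build R (X -> R) (@walters X)
  (@walters_submod_closed X).

Record walters_fun X := WaltersFun {
  walters_val :> X -> R ;
  walters_valP : walters_val \in @walters X }.

HB.instance Definition _ X := [isSub for @walters_val X].
HB.instance Definition _ X := [Choice of walters_fun X by <:].
HB.instance Definition _ X := [SubChoice_isSubLmodule of walters_fun X by <:].

Lemma walters_funP X (r : walters_fun X) : walters_property r.
Proof. by apply/asboolP; exact: (walters_valP r). Qed.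

Lemma walters_normD X (r s : walters_fun X) :
  walters_norm (r + s) <= walters_norm r + walters_norm s.
Proof.
rewrite /walters_norm addrACA -mulrDr lerD ?ler_pM2l//.
  apply: sup_norm_le => x; rewrite (le_trans (ler_normD _ _))// lerD//.
    exact/sup_norm_ub/walters_funP.
  exact/sup_norm_ub/walters_funP.
apply: variation_le => m x y m1 xy.
under eq_bigr do rewrite /= opprD addrACA.
rewrite big_split/= (le_trans (ler_normD _ _))// lerD//.
  exact: variation_ub (walters_funP r) _ _.
exact: variation_ub (walters_funP s) _ _.
Qed.

Lemma walters_normZ_le X a (r : walters_fun X) :
  walters_norm (a *: r) <= `|a| * walters_norm r.
Proof.
rewrite /walters_norm mulrDr mulrCA lerD ?ler_pM2l//.
  apply: sup_norm_le => x; rewrite normrM ler_wpM2l//.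
  exact/sup_norm_ub/walters_funP.
apply: variation_le => m x y m1 xy.
under eq_bigr do rewrite /= -scalerBr.
rewrite -scaler_sumr normrM ler_wpM2l//.
exact: variation_ub (walters_funP r) _ _.
Qed.

Lemma sup_norm_le_walters X (r : walters_fun X) x : `|r x| *+ 2 <= walters_norm r.
Proof.
rewrite -[leLHS]addr0 -mulr_natl lerD ?ler_pM2l//.
  exact/sup_norm_ub/walters_funP.
apply: le_trans (@variation_ub _ r 1 x x (walters_funP r) _ _) => //.
by rewrite metric_structure.mdistxx invr_gt0 exprn_gt0.
Qed.

Lemma walters_normZ X a (r : walters_fun X) :
  walters_norm (a *: r) = `|a| * walters_norm r.
Proof.
have n0 (s : walters_fun X) : 0 <= walters_norm s.
  have [x0 _] := shift_space_point X.
  by apply: le_trans (sup_norm_le_walters s x0); rewrite mulrn_wge0.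
apply/eqP; rewrite eq_le walters_normZ_le andTb.
have [->|a0] := eqVneq a 0; first by rewrite normr0 mul0r; exact: n0.
have := walters_normZ_le a^-1 (a *: r).
by rewrite scalerA mulVf// scale1r normfV ler_pdivlMl ?normr_gt0.
Qed.

Lemma walters_norm_eq0 X (r : walters_fun X) : walters_norm r = 0 -> r = 0.
Proof.
move=> r0; apply/val_inj/funext => x; apply/eqP.
have := sup_norm_le_walters r x.
by rewrite r0 pmulrn_lle0// normr_le0.
Qed.

HB.instance Definition _ X := Lmodule_isNormed.Build R (walters_fun X)
  (@walters_normD X) (@walters_normZ X) (@walters_norm_eq0 X).

Lemma walters_normE X (r : walters_fun X) : `|r| = walters_norm r.
Proof. by []. Qed.

Definition roof_functions X : set (walters_fun X) :=
  [set r | forall x, 0 < r x].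

(* The sum of r (sigma^j x) over 0 <= j < n; for n < 0 it is minus the sum over
   n <= j < 0, the convention that gives the flow for negative times. *)
Definition birkhoff X (r : X -> R) (n : int) (x : X) : R :=
  match n with
  | Posz m => \sum_(j < m) r (iter j (@sigma X) x)
  | Negz m => - \sum_(j < m.+1) r (iter j (@sigma X) (sigmaz (Negz m) x))
  end.

Lemma birkhoff0 X (r : X -> R) x : birkhoff r 0 x = 0.
Proof. by rewrite /birkhoff /= big_ord0. Qed.

Lemma birkhoffS X (r : X -> R) n x :
  birkhoff r (n + 1) x = birkhoff r n x + r (sigmaz n x).
Proof.
case: n => [n|[|n]].
- by rewrite -PoszD addn1 /= big_ord_recr/= iter_sigma.
- by rewrite /= big_ord0 big_ord1 /= addNr.
rewrite (_ : Negz n.+1 + 1 = Negz n); last by rewrite !NegzE; lia.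
rewrite /birkhoff [in RHS]big_ord_recl/= opprD addrAC addNr add0r; congr (- _).
apply: eq_bigr => j _; rewrite -iterS iterSr -sigmaz1 sigmazD.
by congr (r (iter j _ (sigmaz _ x))); rewrite !NegzE; lia.
Qed.

Lemma birkhoffD X (r : X -> R) m n x :
  birkhoff r (m + n) x = birkhoff r n x + birkhoff r m (sigmaz n x).
Proof.
elim/int_ind: m => [|m IH|m IH].
- by rewrite add0r birkhoff0 addr0.
- rewrite (_ : m.+1%:Z + n = m%:Z + n + 1); last lia.
  rewrite birkhoffS IH (_ : m.+1%:Z = m%:Z + 1); last lia.
  by rewrite birkhoffS sigmazD addrA.
- apply: (addIr (r (sigmaz (- m.+1%:Z + n) x))).
  rewrite -birkhoffS (_ : - m.+1%:Z + n + 1 = - m%:Z + n); last lia.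
  rewrite IH -addrA -sigmazD -birkhoffS.
  by rewrite (_ : - m.+1%:Z + 1 = - m%:Z); last lia.
Qed.

Lemma birkhoffN X (r : X -> R) n x :
  birkhoff r (- n) (sigmaz n x) = - birkhoff r n x.
Proof.
have := birkhoffD r (- n) n x.
by rewrite addNr birkhoff0 => /esym/eqP; rewrite addrC addr_eq0 => /eqP.
Qed.

Section Suspension.
Context {X : shift_space R A} (r : X -> R).

Definition under_roof : set (X * R) := [set p | 0 <= p.2 <= r p.1].

Definition glue (p q : under_roof) : Prop :=
  (\val p).2 = r (\val p).1 /\ \val q = (sigma (\val p).1, 0).

Definition glue_equiv : rel under_roof :=
  fun p q => `[< clos_refl_sym_trans under_roof glue p q >].

Lemma glue_equiv_refl : reflexive glue_equiv.
Proof. by move=> p; apply/asboolP; exact: rst_refl. Qed.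

Lemma glue_equiv_sym : symmetric glue_equiv.
Proof. by move=> p q; apply/asboolP/asboolP; exact: rst_sym. Qed.

Lemma glue_equiv_trans : transitive glue_equiv.
Proof.
by move=> q p s /asboolP pq /asboolP qs; apply/asboolP; exact: rst_trans pq qs.
Qed.

Canonical glue_equiv_equiv :=
  EquivRel glue_equiv glue_equiv_refl glue_equiv_sym glue_equiv_trans.

Definition suspension : Type := quotient_topology {eq_quot glue_equiv}.
HB.instance Definition _ := Topological.on suspension.

Definition to_suspension (p : under_roof) : suspension :=
  \pi_{eq_quot glue_equiv} p.

Definition flow_rep (t : R) (p q : under_roof) : Prop :=
  exists2 n : int, (\val q).1 = sigmaz n (\val p).1 &
    birkhoff r n (\val p).1 + (\val q).2 = t + (\val p).2.

(* For a positive r with the Walters property the set below is a singleton: see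
   suspension_flowP. *)
Definition suspension_flow (t : R) (m : suspension) : suspension :=
  xget m [set m' | exists p q, [/\ m = to_suspension p,
                                   m' = to_suspension q & flow_rep t p q]].

Definition topologically_mixing :=
  forall U V : set suspension, open U -> U !=set0 -> open V -> V !=set0 ->
    exists T : R, forall t, T <= t ->
      (suspension_flow t @` U) `&` V !=set0.

Lemma flow_rep_comp a b p q s :
  flow_rep a p q -> flow_rep b q s -> flow_rep (a + b) p s.
Proof.
move=> [m qm em] [n sn en]; exists (n + m); first by rewrite sn qm sigmazD.
by rewrite birkhoffD -qm -addrA en addrCA em addrA (addrC b).
Qed.

Lemma flow_rep_sym a p q : flow_rep a p q -> flow_rep (- a) q p.
Proof.
move=> [m qm em]; exists (- m); first by rewrite qm sigmazD addNr sigmaz0.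
by rewrite qm birkhoffN; move: em; lra.
Qed.

Lemma glue_equiv_flow p q : glue_equiv p q -> flow_rep 0 p q.
Proof.
move/asboolP; elim=> {p q} [p q [e1 e2]|p|p q _ /flow_rep_sym|p q s _ h1 _ h2].
- exists 1; first by rewrite e2 sigmaz1.
  by rewrite /= big_ord1/= e2 e1/= addrC.
- by exists 0; rewrite ?sigmaz0// birkhoff0.
- by rewrite oppr0.
- by rewrite -[0]addr0; exact: flow_rep_comp h1 h2.
Qed.

Lemma flow_glue_equiv p q :
  (forall x, 0 < r x) -> flow_rep 0 p q -> glue_equiv p q.
Proof.
move=> r0.
have nonneg (n : nat) p' q' : (\val q').1 = sigmaz n (\val p').1 ->
    birkhoff r n (\val p').1 + (\val q').2 = 0 + (\val p').2 -> glue_equiv p' q'.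
  have /andP[_ pr] : (0 <= (\val p').2 <= r (\val p').1) := set_valP p'.
  have /andP[q0 _] : (0 <= (\val q').2 <= r (\val q').1) := set_valP q'.
  case: n => [|[|n]] /= qe.
  - rewrite big_ord0 !add0r => e; suff -> : p' = q' by exact: glue_equiv_refl.
    by apply: val_inj; apply/esym; rewrite [LHS]surjective_pairing qe e sigmaz0 -surjective_pairing.
  - rewrite big_ord1/= add0r => e; apply/asboolP/rst_step; split.
      by apply/eqP; rewrite eq_le pr/= -e lerDl.
    rewrite [LHS]surjective_pairing qe sigmaz1; congr pair.
    by apply/eqP; rewrite eq_le q0 andbT; lra.
  - rewrite big_ord_recl big_ord_recl/= add0r => e; exfalso.
    have : 0 <= \sum_(i < n) r (iter (lift ord0 (lift ord0 i)) (@sigma X) (\val p').1).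
      by apply: sumr_ge0 => i _; exact: ltW.
    have := r0 (sigma (\val p').1); move: e; lra.
move=> [[n|n] qe e]; first exact: nonneg qe e.
rewrite glue_equiv_sym.
apply: (nonneg n.+1); first by rewrite qe sigmazD NegzE addrN sigmaz0.
by rewrite qe (_ : n.+1%:Z = - Negz n) ?birkhoffN; [move: e; lra|rewrite NegzE opprK].
Qed.

Lemma to_suspension_eqP p q :
  (forall x, 0 < r x) ->
  to_suspension p = to_suspension q <-> flow_rep 0 p q.
Proof.
move=> r0; split; first by move/eqmodP; exact: glue_equiv_flow.
by move=> h; apply/eqmodP; exact: flow_glue_equiv.
Qed.

Lemma suspension_flow_unique t p p' q q' : (forall x, 0 < r x) ->
  to_suspension p = to_suspension p' -> flow_rep t p q -> flow_rep t p' q' ->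
  to_suspension q = to_suspension q'.
Proof.
move=> r0 /(to_suspension_eqP _ _ r0) pp pq pq'; apply/(to_suspension_eqP _ _ r0).
rewrite (_ : 0 = - t + (0 + t)); last by rewrite add0r addNr.
exact: flow_rep_comp (flow_rep_sym pq) (flow_rep_comp pp pq').
Qed.

Lemma birkhoff_ge c (n : nat) x : (forall x, c <= r x) -> c *+ n <= birkhoff r n x.
Proof.
by move=> rc; rewrite /birkhoff -[n in leLHS]card_ord -sumr_const ler_sum.
Qed.

Lemma flow_rep_total t p : walters_property r -> (forall x, 0 < r x) ->
  exists q, flow_rep t p q.
Proof.
move=> wr r0; have [c c0 rc] := walters_pos_lbound wr r0.
set x := (\val p).1; set u := t + (\val p).2.
pose N := (Num.truncn (`|u| / c)).+1.
have uN : `|u| < c *+ N.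
  by rewrite -mulr_natr mulrC -ltr_pdivrMr// truncnS_gt.
pose P k := u < birkhoff r (k%:Z - N%:Z) x.
have exP : exists k, P k.
  exists (N + N)%N; rewrite /P (_ : _ - _ = N%:Z); last lia.
  by apply: lt_le_trans (birkhoff_ge _ _ rc); exact: le_lt_trans (ler_norm _) uN.
case: (ex_minnP exP) => -[|k] Pk kmin.
  exfalso; move: Pk; rewrite /P sub0r ltNge => /negP; apply.
  have := birkhoffN r (- N%:Z) x; rewrite opprK => h.
  have := birkhoff_ge N (sigmaz (- N%:Z) x) rc; rewrite h lerNr => /le_trans; apply.
  by rewrite lerNl; apply: le_trans (ltW uN); rewrite -normrN ler_norm.
have /negP : ~~ P k by apply/negP => /kmin; rewrite ltnn.
rewrite /P => /negP; rewrite -leNgt => lo.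
have hi : u < birkhoff r (k%:Z - N%:Z) x + r (sigmaz (k%:Z - N%:Z) x).
  by rewrite -birkhoffS (_ : k%:Z - N%:Z + 1 = k.+1%:Z - N%:Z)//; lia.
set n : int := k%:Z - N%:Z in lo hi.
have qP : under_roof (sigmaz n x, u - birkhoff r n x).
  by apply/andP; rewrite /= subr_ge0 lo lerBlDl ltW.
by exists (SigSub (mem_set qP)), n => //=; rewrite addrC subrK.
Qed.

Lemma suspension_flowP t p q : walters_property r -> (forall x, 0 < r x) ->
  suspension_flow t (to_suspension p) = to_suspension q <-> flow_rep t p q.
Proof.
move=> wr r0.
have [q0 pq0] := flow_rep_total t p wr r0.
have e : suspension_flow t (to_suspension p) = to_suspension q0.
  rewrite /suspension_flow; case: xgetP => [m _ [p' [q' [pp -> pq']]]|/(_ (to_suspension q0))].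
    by apply: suspension_flow_unique pq' pq0 => //.
  by case; exists p, q0.
split=> [|pq]; last by rewrite e; exact: suspension_flow_unique pq0 pq.
rewrite e => /(to_suspension_eqP _ _ r0) qq; rewrite -[t]addr0.
exact: flow_rep_comp pq0 qq.
Qed.

End Suspension.

End ShiftSpace.

Arguments roof_functions {R A} X.

(* Main.v *)
Require Import Defs.
From mathcomp Require Import all_boot all_order all_algebra.
From mathcomp Require Import all_classical all_reals all_analysis borel_hierarchy.
From mathcomp Require Import zify ring lra.

(** Mixing is equivalent to the existence, for every d > 0, of two closed orbits
    whose periods (possibly traversed several times) differ by an amount in
    (0, d). If the flow is mixing, a thin box returns to itself at all large
    times, and by the closing lemma and the Walters property each such time is
    close to the period of a closed orbit. Conversely, if a - b is in (0, d) for
    two such periods, then the numbers j a + k b are eventually d-dense, and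
    orbits running from a given cylinder to another one can loop j times along
    one closed orbit and k times along the other, the error being bounded
    independently of j and k. The criterion is a countable intersection of
    conditions that are open in the roof function, since each period depends
    continuously on it. For density, add to the roof function a small multiple
    of the indicator of a cylinder visited by one closed orbit but not by
    another: this changes one period only, so their ratio can be made
    irrational. *)

Set Implicit Arguments.
Unset Strict Implicit.
Unset Printing Implicit Defensive.

Import Order.TTheory GRing.Theory Num.Theory.
Import numFieldNormedType.Exports.

Local Open Scope classical_set_scope.
Local Open Scope ring_scope.

(** * Splicing and closing orbits in a subshift of finite type *)

Section Orbits.
Context {R : realType} {A : finType}.

Definition agree (m : nat) (x y : fullshift R A) :=
  forall i : int, (absz i <= m)%N -> x i = y i.

Lemma agree_sym m x y : agree m x y -> agree m y x.
Proof. by move=> xy i im; rewrite xy. Qed.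

Lemma agree_trans m x y z : agree m x y -> agree m y z -> agree m x z.
Proof. by move=> xy yz i im; rewrite xy// yz. Qed.

Lemma agree_le l m x y : (l <= m)%N -> agree m x y -> agree l x y.
Proof. by move=> lm xy i il; rewrite xy// (leq_trans il). Qed.

Lemma block_transfer (x y : fullshift R A) (i i' : int) (w : seq A) :
  (forall j, (j < size w)%N -> y (i + j%:Z) = x (i' + j%:Z)) ->
  block y i (size w) = w -> block x i' (size w) = w.
Proof.
move=> yx yw; rewrite -[RHS]yw; apply/eq_in_map => j.
by rewrite mem_iota add0n => /andP[_ jw]; rewrite yx.
Qed.

Context {X : shift_space R A}.

(** With [M] the maximal length of a forbidden word, a forbidden word in [y] would lie in a window
    copied from a point of [X]. *)
Lemma sft_local : subshift_finite_type X ->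
  exists M : nat, forall y : fullshift R A,
    (forall i : int, exists (x : X) (i' : int),
       forall j : nat, (j < M)%N -> y (i + j%:Z) = \val x (i' + j%:Z)) ->
    ss_set X y.
Proof.
move=> [F XF]; exists (\max_(w <- F) size w)%N => y ylocal.
have avoid z : ss_set X z -> forall w, w \in F -> ~ occurs w z by rewrite XF.
rewrite XF => w wF [i yw]; have [x [i' yx]] := ylocal i.
apply: (avoid _ (set_valP x) w wF); exists i'.
apply: block_transfer yw => j jw; apply: yx; apply: leq_trans jw _.
by rewrite (big_rem w)//= leq_maxl.
Qed.

Lemma nth_block (x : fullshift R A) i l a j :
  (j < l)%N -> nth a (block x i l) j = x (i + j%:Z).
Proof. by move=> jl; rewrite (nth_map 0%N) ?size_iota// nth_iota. Qed.

Lemma size_block (x : fullshift R A) i l : size (block x i l) = l.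
Proof. by rewrite size_map size_iota. Qed.

Lemma connecting_orbit (m : nat) (a b : X) : transitive_shift X ->
  exists n : nat, exists y : X, [/\ (0 < n)%N, agree m (\val y) (\val a) &
    agree m (\val (sigmaz n%:Z y)) (\val b)].
Proof.
move=> trX; set l := (m.*2.+1)%N.
have blockX (c : X) : language X (block (\val c) (- m%:Z) l).
  by exists (\val c); [exact: set_valP|exists (- m%:Z); rewrite size_block].
have [w _ [x Xx [i]]] := trX _ _ (blockX a) (blockX b).
rewrite !size_cat !size_block => xw.
pose x' : X := SigSub (mem_set Xx).
have coord (j : nat) : (j < l + (size w + l))%N -> x (i + j%:Z) =
    nth (x 0) (block (\val a) (- m%:Z) l ++ w ++ block (\val b) (- m%:Z) l) j.
  by move=> jl; rewrite -xw nth_block.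
(* [l + size w] is the distance between the centres of the two blocks, and the shift puts the first
   centre at [0]. *)
exists (l + size w)%N, (sigmaz (i + m%:Z) x'); split => [//|k km|k km] /=.
- rewrite /shiftz (_ : k + _ = i + (absz (k + m%:Z))%:Z); last lia.
  rewrite coord; last lia.
  rewrite nth_cat size_block ifT; last lia.
  by rewrite nth_block; [congr (\val a _)|]; lia.
- rewrite /shiftz (_ : k + _ + _ = i + (l + size w + absz (k + m%:Z))%:Z); last lia.
  rewrite coord; last lia.
  rewrite nth_cat size_block ifF; last lia.
  rewrite nth_cat ifF; last lia.
  by rewrite nth_block; [congr (\val b _)|]; lia.
Qed.

(** Follow [x] before time [n] and [x'] from then on. Windows of length [M] starting at or before
    [n] come from [x], all later ones from [x'], because the overlap reaches [m >= M] places to both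
    sides. *)
Lemma glue_orbits : subshift_finite_type X -> exists M : nat,
  forall (m n : nat) (x x' : X), (M <= m)%N ->
    agree m (\val (sigmaz n%:Z x)) (\val x') ->
    exists y : X, (forall i, i <= (n + m)%:Z -> \val y i = \val x i) /\
      (forall i, - m%:Z <= i -> \val (sigmaz n%:Z y) i = \val x' i).
Proof.
move=> /sft_local[M local]; exists M => m n x x' Mm xx'.
pose y : fullshift R A := fun i => if i < n%:Z then \val x i else \val x' (i - n%:Z).
have yx i : i <= (n + m)%:Z -> y i = \val x i.
  rewrite /y; case: ifPn => // ni im.
  rewrite -xx' /=; last lia.
  by rewrite /shiftz subrK.
have yx' i : - m%:Z <= i -> y (i + n%:Z) = \val x' i.
  rewrite /y; case: ifPn => [ni im|ni _]; last by rewrite addrK.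
  by rewrite -xx' //; lia.
have Xy : ss_set X y.
  apply: local => i; have [ni|ni] := leP i n%:Z.
    by exists x, i => j jM; rewrite yx//; lia.
  exists x', (i - n%:Z) => j jM.
  by rewrite (_ : i + j%:Z = i - n%:Z + j%:Z + n%:Z) ?yx'//; lia.
by exists (SigSub (mem_set Xy)); split => i ?; [exact: yx|exact: yx'].
Qed.

(** Repeat the first [n] letters of [x] periodically. Up to a multiple of [n], a window of length
    [M] starts in [[0, n)] and ends before [n + m], where the repetition still agrees with [x]. *)
Lemma close_orbit : subshift_finite_type X -> exists M : nat,
  forall (m n : nat) (x : X), (M <= m)%N -> (0 < n)%N ->
    agree m (\val (sigmaz n%:Z x)) (\val x) ->
    exists2 z : X, sigmaz n%:Z z = z &
      forall i, - m%:Z <= i <= (n + m)%:Z -> \val z i = \val x i.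
Proof.
move=> /sft_local[M local]; exists M => m n x Mm n0 xx.
pose z : fullshift R A := fun i => \val x (i %% n%:Z)%Z.
have per i : z (i + n%:Z) = z i by rewrite /z modzDr.
have xper i : (absz i <= m)%N -> \val x (i + n%:Z) = \val x i by exact: xx.
have zlt i : 0 <= i < n%:Z -> z i = \val x i by move=> /modz_small e; rewrite /z e.
have zpos (k : nat) : (k <= n + m)%N -> z k%:Z = \val x k%:Z.
  elim/ltn_ind: k => k IH km; have [kn|nk] := ltnP k n; first by rewrite zlt//; lia.
  rewrite (_ : k%:Z = (k - n)%N%:Z + n%:Z); last lia.
  by rewrite per xper ?IH//; lia.
have zneg (k : nat) : (k <= m)%N -> z (- k%:Z) = \val x (- k%:Z).
  elim/ltn_ind: k => k IH km; rewrite -per -xper; last lia.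
  have [kn|nk] := leqP k n.
    by rewrite (_ : - k%:Z + n%:Z = (n - k)%N%:Z) ?zpos//; lia.
  by rewrite (_ : - k%:Z + n%:Z = - (k - n)%N%:Z) ?IH//; lia.
have Xz : ss_set X z.
  apply: local => i; exists x, (i %% n%:Z)%Z => j jM.
  have := ltz_pmod i (_ : 0 < n%:Z); have := modz_ge0 i (_ : n%:Z != 0) => h1 h2.
  have e1 := h1 ltac:(lia); have e2 := h2 ltac:(lia).
  transitivity (z ((i %% n%:Z)%Z + j%:Z)); first by rewrite /z modzDml.
  by rewrite (_ : _ + _ = (absz (i %% n%:Z)%Z + j)%N%:Z) ?zpos//; lia.
exists (SigSub (mem_set Xz)); first by apply/val_inj/funext => i /=; exact: per.
move=> i /andP[mi im] /=; have [i0|i0] := leP 0 i.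
  by rewrite (_ : i = (absz i)%:Z) ?zpos//; lia.
by rewrite (_ : i = - (absz i)%:Z) ?zneg//; lia.
Qed.

End Orbits.

(** * Combinations and irrational ratios of two lengths *)

Section Numbers.
Context {R : realType}.
Implicit Types a b d t : R.

(** Trading one [b] for one [a] raises a sum by [a - b < d], and about [b / (a - b)] trades bridge
    two consecutive multiples of [b]. A large [t] provides enough copies of [b] to trade. *)
Lemma eventually_dense_combinations a b d : 0 <= b -> 0 < a - b -> a - b < d ->
  exists T : R, forall t, T <= t ->
    exists j k : nat, t - d < a *+ j + b *+ k <= t.
Proof.
move=> b0 g0 gd; set g := a - b in g0 gd.
have stepP (c u : R) : 0 < c -> 0 <= u -> exists j : nat, c *+ j <= u < c *+ j + c.
  move=> c0 u0; exists (Num.truncn (u / c)).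
  have /andP[lo hi] := truncn_itv (divr_ge0 u0 (ltW c0)).
  rewrite -mulrSr -[c *+ _]mulr_natl -[c *+ _.+1]mulr_natl.
  by rewrite -ler_pdivlMr// lo -ltr_pdivrMr.
have [b00|bn0] := eqVneq b 0.
  have ga : g = a by rewrite /g b00 subr0.
  exists 0 => t t0; have [j /andP[lo hi]] := stepP a t ltac:(by rewrite -ga) t0.
  by exists j, 0%N; rewrite mulr0n addr0 lo andbT; lra.
have bp : 0 < b by rewrite lt_def bn0.
have [N /andP[_ bN]] := stepP g b g0 b0.
exists (b *+ N.+1) => t tN.
have t0 : 0 <= t by apply: le_trans tN; rewrite mulrn_wge0.
have [M /andP[Mlo Mhi]] := stepP b t bp t0.
have NM : (N < M)%N.
  rewrite ltnNge; apply/negP => MN.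
  have : b *+ M <= b *+ N by rewrite ler_wpMn2l.
  by move: tN; rewrite mulrS; lra.
have [j /andP[jlo jhi]] := stepP g (t - b *+ M) g0 ltac:(lra).
have jN : (j <= N)%N.
  rewrite leqNgt; apply/negP => Nj.
  have : g *+ N.+1 <= g *+ j by rewrite ler_wpMn2l// ltW.
  by rewrite mulrS; lra.
exists j, (M - j)%N.
have e : a *+ j + b *+ (M - j) = b *+ M + g *+ j.
  by rewrite mulrnBr ?(leq_trans jN (ltnW NM))// /g mulrnBl; lra.
by rewrite e; apply/andP; split; lra.
Qed.

(** Dirichlet's pigeonhole argument: two of [N + 1] multiples of [a / b] have fractional parts less
    than [1 / N] apart, and [b / N < d]. Irrationality keeps the combination nonzero. *)
Lemma irrational_small_combination a b d : 0 < a -> 0 < b -> 0 < d ->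
  irrational (a / b) -> exists j k : nat, 0 < `|a *+ j - b *+ k| < d.
Proof.
move=> a0 b0 d0 irr; pose th := a / b.
have th0 : 0 < th by rewrite divr_gt0.
pose N := (Num.truncn (b / d)).+1.
have bN : b < d *+ N by rewrite -mulr_natl -ltr_pdivrMr// truncnS_gt.
pose q (j : nat) : nat := Num.truncn (th *+ j).
have qP j : (q j)%:R <= th *+ j < (q j).+1%:R by rewrite truncn_itv// mulrn_wge0// ltW.
(* The fractional part is scaled by [N], so that its truncation is the index of its pigeonhole. *)
pose fr (j : nat) : R := (th *+ j - (q j)%:R) *+ N.
have frP j : 0 <= fr j < N%:R.
  have /andP[lo] := qP j; rewrite -natr1 => hi.
  rewrite /fr mulrn_wge0 ?subr_ge0//=.
  by rewrite -[X in _ < X]/(1 *+ N) ltr_pMn2r// ltrBlDl.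
have idx_lt j : (Num.truncn (fr j) < N)%N.
  have /andP[f0 fN] := frP j; have /andP[lo _] := truncn_itv f0.
  by rewrite -(ltr_nat R); exact: le_lt_trans lo fN.
pose idx (j : 'I_N.+1) : 'I_N := Ordinal (idx_lt j).
have [i [j [ij eij]]] : exists i j : 'I_N.+1, (i < j)%N /\ idx i = idx j.
  apply: contrapT => ninj.
  suff /leq_card : injective idx by rewrite !card_ord ltnn.
  move=> i j eij; apply/val_inj; case: (ltngtP i j) => // ij; exfalso; apply: ninj.
    by exists i, j.
  by exists j, i.
have {eij} etr : Num.truncn (fr i) = Num.truncn (fr j) by move/(congr1 val): eij.
have close : `|fr j - fr i| < 1.
  have /andP[fi0 _] := frP i; have /andP[fj0 _] := frP j.
  have := truncn_itv fi0; have := truncn_itv fj0; rewrite etr -natr1.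
  by move=> /andP[? ?] /andP[? ?]; rewrite ltr_norml; apply/andP; split; lra.
have qij : (q i <= q j)%N by apply: le_truncn; apply: ler_wpMn2l; [exact: ltW|exact: ltnW].
exists (j - i)%N, (q j - q i)%N.
have e : (fr j - fr i) * b = (a *+ (j - i) - b *+ (q j - q i)) *+ N.
  rewrite /fr !mulrnBr ?(ltnW ij)// -mulrnBl mulrnAl.
  congr (_ *+ _); rewrite -[th *+ _]mulr_natl -[a *+ _]mulr_natl -[b *+ _]mulr_natl /th.
  by field; lra.
apply/andP; split.
  rewrite normr_gt0; apply/negP => /eqP z; apply: irr.
  exists ((q j - q i)%N%:R / (j - i)%N%:R) => //.
  rewrite fmorph_div !rmorph_nat; apply/eqP; rewrite eqr_div; first last.
  - by lra.
  - by rewrite pnatr_eq0; lia.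
  by move: z; rewrite -[a *+ _]mulr_natl -[b *+ _]mulr_natl; lra.
have N0 : (0 < N)%N by [].
rewrite -(ltr_pMn2r N0) -normrMn -e normrM (gtr0_norm b0).
by apply: lt_trans bN; rewrite gtr_pMl.
Qed.

(** The translates of [pi] by rationals are irrational and dense. *)
Lemma irrational_translate a d : 0 < d ->
  exists t, 0 < t < d /\ irrational (a + t).
Proof.
move=> d0; have [||x [xI [q _ qx]]] := @dense_rat R `]a - pi, a + d - pi[%classic.
- by exists (a - pi + d / 2); rewrite /= in_itv/=; apply/andP; split; lra.
- exact: interval_open.
move: xI; rewrite /= in_itv/= => /andP[x1 x2].
exists (x + pi - a); split; first by apply/andP; split; lra.
rewrite (_ : a + _ = x + pi); last ring.
move=> [p _ pe]; apply: (@pi_irrationnal R); exists (p - q) => //.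
by rewrite rmorphB/= pe qx addrC addKr.
Qed.

End Numbers.

(** * Birkhoff sums along spliced orbits *)

Section BirkhoffSums.
Context {R : realType} {A : finType} {X : shift_space R A}.
Implicit Types (x y z : X) (r : X -> R).

Lemma sigmaz_periodic (n : int) z (j : nat) :
  sigmaz n z = z -> sigmaz (n *+ j) z = z.
Proof.
move=> zz; elim: j => [|j IH]; first by rewrite mulr0n sigmaz0.
by rewrite mulrS -sigmazD IH.
Qed.

Lemma birkhoff_periodic r (n : int) z (j : nat) :
  sigmaz n z = z -> birkhoff r (n *+ j) z = birkhoff r n z *+ j.
Proof.
move=> zz; elim: j => [|j IH]; first by rewrite !mulr0n birkhoff0.
by rewrite !mulrS birkhoffD IH (sigmaz_periodic j zz) addrC.
Qed.

Lemma birkhoff_agree r (e : R) : walters_property r -> 0 < e ->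
  exists k : nat, forall (m n : nat) x y, (k <= m)%N ->
    (forall i, - m%:Z <= i <= (n + m)%:Z -> \val x i = \val y i) ->
    `|birkhoff r n x - birkhoff r n y| < e.
Proof.
move=> wr e0; have [k hk] := wr e e0; exists k => m n x y km xy.
rewrite /birkhoff -sumrB; apply: hk; apply/block_eqP => j jl; apply: xy; lia.
Qed.

(* Some orbit segment runs from the [m]-cylinder of [a] to that of [b] with
   Birkhoff sum [l], up to the error [e]. *)
Definition segment r (m : nat) (a b : X) (l e : R) := exists (n : nat) y,
  [/\ agree m (\val y) (\val a), agree m (\val (sigmaz n%:Z y)) (\val b) &
      `|birkhoff r n y - l| <= e].

Lemma segment_connect r m a b : transitive_shift X ->
  exists l, segment r m a b l 0.
Proof.
move=> /(connecting_orbit m a b)[n [y [_ ya yb]]].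
by exists (birkhoff r n y), n, y; split => //; rewrite subrr normr0.
Qed.

Lemma segment_periodic r m (n : nat) z (j : nat) : sigmaz n%:Z z = z ->
  segment r m z z (birkhoff r n z *+ j) 0.
Proof.
move=> zz; exists (n * j)%N, z.
have -> : (n * j)%N%:Z = n%:Z *+ j by lia.
by rewrite (sigmaz_periodic j zz) (birkhoff_periodic r j zz) subrr normr0.
Qed.

(** By the Walters property, splicing changes the sum over each of the two pieces by less than
    [e / 2], however long they are. *)
Lemma segment_glue r (e : R) : subshift_finite_type X ->
  walters_property r -> 0 < e ->
  exists k : nat, forall m a b c l l' d d', (k <= m)%N ->
    segment r m a b l d -> segment r m b c l' d' ->
    segment r m a c (l + l') (d + d' + e).
Proof.
move=> /glue_orbits[M glue] wr e0.
have [k hk] := birkhoff_agree wr (divr_gt0 e0 (ltr0Sn R 1)).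
exists (maxn M k) => m a b c l l' d d' km.
move=> [n [x [xa xb xl]]] [n' [x' [x'b x'c x'l]]].
have [||y [yx yx']] := glue m n x x'; first by lia.
  exact: agree_trans xb (agree_sym x'b).
exists (n' + n)%N, y; split.
- by apply: agree_trans xa => i im; apply: yx; lia.
- apply: agree_trans x'c => i im.
  by rewrite PoszD -sigmazD; apply: (yx' (i + n'%:Z)); lia.
have h1 : `|birkhoff r n y - birkhoff r n x| < e / 2.
  by apply: (hk m) => [|i /andP[_ im]]; [lia|exact: yx].
have h2 : `|birkhoff r n' (sigmaz n%:Z y) - birkhoff r n' x'| < e / 2.
  by apply: (hk m) => [|i /andP[im _]]; [lia|exact: yx'].
rewrite PoszD birkhoffD.
move: xl x'l h1 h2; rewrite !ler_norml !ltr_norml.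
by move=> /andP[? ?] /andP[? ?] /andP[? ?] /andP[? ?]; apply/andP; split; lra.
Qed.

(* [n1] and [n2] need not be the least periods, and may be [0]. *)
Definition close_periods r := forall d : R, 0 < d ->
  exists (n1 n2 : nat) z1 z2, [/\ sigmaz n1%:Z z1 = z1, sigmaz n2%:Z z2 = z2 &
    0 < birkhoff r n1 z1 - birkhoff r n2 z2 < d].

Lemma segment_eventually r (d : R) (k : nat) (a b : X) :
  subshift_finite_type X -> transitive_shift X -> walters_property r ->
  (forall x, 0 < r x) -> close_periods r -> 0 < d ->
  exists T : R, forall t, T <= t -> segment r k a b t d.
Proof.
move=> Xsft Xtr wr r0 cp d0.
have d2 : 0 < d / 2 by rewrite divr_gt0.
have [n1 [n2 [z1 [z2 [zz1 zz2 /andP[g0 gd]]]]]] := cp _ d2.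
have [|T hT] := eventually_dense_combinations _ g0 gd.
  by apply: sumr_ge0 => j _; exact: ltW.
(* Four junctions at [d / 8] each leave [d / 2] for the gap between [t] and the nearest combination
   below it. *)
have [M glue] := segment_glue Xsft wr (divr_gt0 d0 (ltr0Sn R 7)).
set m := maxn M k; have Mm : (M <= m)%N by rewrite leq_maxl.
have [l1 s1] := segment_connect r m a z1 Xtr.
have [l2 s2] := segment_connect r m z1 z2 Xtr.
have [l3 s3] := segment_connect r m z2 b Xtr.
exists (T + (l1 + l2 + l3)) => t tT.
have [j [i /andP[lo hi]]] := hT (t - (l1 + l2 + l3)) ltac:(lra).
(* Looping [j] times along [z1] and [i] times along [z2] costs no error by
   itself: only the four junctions do, hence the bound is uniform in [t]. *)
have s := glue _ _ _ _ _ _ _ _ Mm s1 (segment_periodic r m j zz1).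
have {}s := glue _ _ _ _ _ _ _ _ Mm s s2.
have {}s := glue _ _ _ _ _ _ _ _ Mm s (segment_periodic r m i zz2).
have [n [y [ya yb yl]]] := glue _ _ _ _ _ _ _ _ Mm s s3.
exists n, y; split.
- by apply: agree_le ya; rewrite leq_maxr.
- by apply: agree_le yb; rewrite leq_maxr.
move: yl; rewrite !ler_norml => /andP[? ?]; apply/andP; split; lra.
Qed.

End BirkhoffSums.

(** * Mixing of the suspension flow and close periods *)

Section Flow.
Context {R : realType} {A : finType} {X : shift_space R A}.
Implicit Types (x y z : X) (r : X -> R).

Lemma nbhs_agree x (k : nat) : nbhs x [set y : X | agree k (\val y) (\val x)].
Proof.
have bx : nbhs (\val x) [set y | mdist (\val x) y < 2 ^- k].
  have := @nbhsx_ballx R (fullshift R A) (\val x) (2 ^- k).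
  by rewrite ballEmdist; apply; rewrite invr_gt0 exprn_gt0.
have := @initial_continuous _ _ (set_val : X -> fullshift R A) x _ bx.
apply: (@filterS X (nbhs x) (nbhs_filter x)) => y /dist_ltP xy i ik.
by rewrite xy.
Qed.

Lemma agree_nbhs x (P : set X) : nbhs x P ->
  exists k : nat, forall y, agree k (\val y) (\val x) -> P y.
Proof.
move=> [_ [[W oW <-] Wx WP]].
have := open_nbhs_nbhs (conj oW Wx); rewrite -nbhs_ballE => -[e /= e0 eW].
have [k ke] : exists k : nat, 2 ^- k < e.
  have /cvgrPdist_lt/(_ _ e0)[k _ /(_ k (leqnn k))] :
      (fun n => 2^-1 ^+ n : R) @ \oo --> 0.
    by apply: cvg_expr; rewrite ger0_norm ?invr_ge0// invf_lt1 ?ltr1n.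
  rewrite /= sub0r normrN ger0_norm ?exprn_ge0 ?invr_ge0// exprVn => h.
  by exists k.
exists k => y yx; apply: WP; apply: eW; rewrite ballEmdist.
by apply: lt_trans ke; apply/dist_ltP; exact: agree_sym.
Qed.

Lemma suspension_box r (U : set (suspension r)) : walters_property r ->
  (forall x, 0 < r x) -> open U -> U !=set0 ->
  exists x (s : R) (k : nat) (d : R), 0 < d /\
    forall y u, agree k (\val y) (\val x) -> `|u - s| < d ->
      exists2 q : under_roof r, \val q = (y, u) & U (to_suspension q).
Proof.
move=> wr r0 oU [m Um].
have [p pm] : exists p : under_roof r, to_suspension p = m.
  by exists (repr m); exact: reprK.
have oU' : open (@to_suspension _ _ _ r @^-1` U) by exact: oU.
have : nbhs p (@to_suspension _ _ _ r @^-1` U).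
  by apply: open_nbhs_nbhs; split => //; rewrite /= pm.
case: p pm => -[x s] /= xsP _ [_ [[W oW <-] Wp WU]].
have /= [[P Q] /= [nP nQ] PQW] := open_nbhs_nbhs (conj oW Wp).
have [k kP] := agree_nbhs nP.
move: nQ; rewrite -nbhs_ballE => -[e /= e0 eQ].
have /andP[/= s0 sr] : 0 <= s <= r x by have := xsP; rewrite inE.
have rx := r0 x.
pose h := Num.min e (r x / 2).
have h0 : 0 < h by rewrite lt_min e0 divr_gt0.
have [he hr] : h <= e /\ h <= r x / 2 by rewrite /h !ge_min !lexx orbT.
(* At the floor or the roof, [under_roof] contains only one side of a height interval. The height
   [s] is therefore moved inwards, by less than [e]. *)
have [s' [s'0 s'r ss']] : exists s' : R, [/\ h / 4 <= s', s' + h / 4 <= r x &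
    `|s' - s| + h / 4 < e].
  have [sh|hs] := leP s (r x / 2).
    exists (s + h / 4); split; [lra|lra|].
    by rewrite addrAC subrr add0r gtr0_norm; lra.
  exists (s - h / 2); split; [lra|lra|].
  by rewrite addrAC subrr add0r normrN gtr0_norm; lra.
have [l hl] : exists l, forall y, agree l (\val y) (\val x) -> r x - h / 8 < r y.
  apply: agree_nbhs; have := @walters_continuous _ _ _ _ wr x.
  move=> /(@cvgrPdist_lt _ _ _ (nbhs x) (nbhs_filter x)) /(_ (h / 8) ltac:(lra)).
  by apply: (@filterS X (nbhs x) (nbhs_filter x)) => y; rewrite ltr_norml => /andP[]; lra.
exists x, s', (maxn k l), (h / 8); split; first lra.
move=> y u yx; rewrite ltr_norml => /andP[u1 u2].
have yP : (y, u) \in under_roof r.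
  rewrite inE /under_roof /=.
  have := hl y (agree_le (leq_maxr k l) yx) => ry.
  by apply/andP; split; lra.
exists (SigSub yP) => //; apply: WU; apply: PQW; split => /=.
  exact: kP (agree_le (leq_maxl k l) yx).
apply: eQ; rewrite /ball/=; have := ler_normD (s - s') (s' - u).
rewrite addrA subrK [`|s - s'|]distrC => /le_lt_trans; apply.
apply: le_lt_trans ss'; rewrite lerD2l ler_norml; apply/andP; split; lra.
Qed.

Lemma close_periods_mixing r : subshift_finite_type X -> transitive_shift X ->
  walters_property r -> (forall x, 0 < r x) ->
  close_periods r -> topologically_mixing r.
Proof.
move=> Xsft Xtr wr r0 cp U V oU U0 oV V0.
have [a [s [k [d [d0 hU]]]]] := suspension_box wr r0 oU U0.
have [b [s' [k' [d' [d'0 hV]]]]] := suspension_box wr r0 oV V0.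
have [T hT] := segment_eventually (maxn k k') a b Xsft Xtr wr r0 cp
  (divr_gt0 d'0 (ltr0Sn R 1)).
(* Flowing from height [s] to height [s'] along a segment of sum [l] takes time [l - s + s']. The
   error of the segment is absorbed by the height of the box in [V]. *)
exists (T - s + s') => t tT.
have [n [y [ya yb yl]]] := hT (t + s - s') ltac:(lra).
have [|p pE Up] := hU y s (agree_le (leq_maxl _ _) ya).
  by rewrite subrr normr0.
have [|q qE Vq] := hV _ (t + s - birkhoff r n y) (agree_le (leq_maxr _ _) yb).
  rewrite distrC; apply: le_lt_trans (_ : d' / 2 < d'); last lra.
  by move: yl; congr (`| _ | <= _); ring.
exists (to_suspension q); split => //; exists (to_suspension p) => //.
apply/(suspension_flowP _ _ _ wr r0); exists n%:Z; first by rewrite pE qE.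
by rewrite pE qE /=; ring.
Qed.

(* An orbit from a thin box over the cylinder of [x] back to itself at time [t]
   closes up to a periodic orbit of period about [t]. *)
Lemma mixing_period r (d : R) x : subshift_finite_type X -> walters_property r ->
  (forall x, 0 < r x) -> 0 < d -> topologically_mixing r ->
  exists T : R, forall t, T <= t ->
    exists (n : nat) z, sigmaz n%:Z z = z /\ `|birkhoff r n z - t| < d.
Proof.
move=> Xsft wr r0 d0 mix.
have [c c0 rc] := walters_pos_lbound wr r0.
have [M close] := close_orbit Xsft.
have [k hk] := birkhoff_agree wr (divr_gt0 d0 (ltr0Sn R 1)).
pose m := maxn M k; pose h := Num.min c (d / 2).
have h0 : 0 < h by rewrite lt_min c0 divr_gt0.
have [hc hd] : h <= c /\ h <= d / 2 by rewrite /h !ge_min !lexx orbT.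
(* As [h] is at most the lower bound [c] of the roof, [B] meets neither floor nor roof. It is thus
   saturated for the gluing, and its image is open. *)
pose B : set (under_roof r) :=
  [set p | agree m (\val (\val p).1) (\val x) /\ 0 < (\val p).2 < h].
have Bglue p q : glue_equiv p q -> B p <-> B q.
  move=> /asboolP; elim=> {p q} [p q [e1 e2]|//|p q _ <-//|p q s _ -> _ -> //].
  split=> -[_ /andP[]].
    by rewrite e1 => _; have := rc (\val p).1; lra.
  by rewrite e2 /= ltxx.
have BE : @to_suspension _ _ _ r @^-1` (@to_suspension _ _ _ r @` B) = B.
  apply/seteqP; split => [p [q Bq /eqmodP /Bglue <- //]|p Bp]; by exists p.
have oB : open B.
  exists ([set y : X | agree m (\val y) (\val x)]^° `*` [set u : R | 0 < u < h]).
    rewrite openE => -[y u] /= [yx uh].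
    have nu : nbhs u [set u : R | 0 < u < h].
      rewrite (_ : [set u | _] = `]0, h[%classic).
        by apply: open_nbhs_nbhs; split; [exact: interval_open|rewrite /= in_itv].
      by apply/seteqP; split => v; rewrite /= in_itv.
    exists ([set y : X | agree m (\val y) (\val x)]^°, [set u : R | 0 < u < h]) => //.
    by split => //=; apply: open_nbhs_nbhs; split => //; exact: open_interior.
  apply/seteqP; split => p /= [p1 p2]; split => //.
    exact: interior_subset p1.
  apply: (@filterS X (nbhs (\val p).1) (nbhs_filter _)) (nbhs_agree (\val p).1 m).
  by move=> y yp; exact: agree_trans yp p1.
have oU : open (@to_suspension _ _ _ r @` B).
  by rewrite /open /= /quotient_open -/(@to_suspension _ _ _ r) BE.
have U0 : @to_suspension _ _ _ r @` B !=set0.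
  have xP : (x, h / 2) \in under_roof r.
    by rewrite inE /under_roof/=; have := rc x => ?; apply/andP; split; lra.
  exists (to_suspension (SigSub xP)), (SigSub xP) => //.
  by split => //=; apply/andP; split; lra.
have [T hT] := mix _ _ oU U0 oU U0.
(* Heights in the box differ by less than [h], so a return time of at least [h + h] forces [n > 0]
   below. *)
exists (Num.max T (h + h)) => t; rewrite ge_max => /andP[tT th].
have [u [[_ [p Bp <-] flow] [q Bq qE]]] := hT t tT.
move: flow; rewrite -qE => /(suspension_flowP _ _ _ wr r0)[n qn bn].
move: Bp Bq => [px /andP[p0 ph]] [qx /andP[q0 qh]].
case: n qn bn => [[|n]|n] qn bn.
- by move: bn; rewrite birkhoff0; lra.
- have [||z zz zp] := close m n.+1 (\val p).1 _ isT.
  + by rewrite leq_maxl.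
  + by rewrite -qn; exact: agree_trans qx (agree_sym px).
  exists n.+1, z; split => //.
  have := hk m n.+1 z (\val p).1 (leq_maxr _ _) zp.
  rewrite !ltr_norml => /andP[? ?]; apply/andP; split; lra.
- have : birkhoff r (Negz n) (\val p).1 <= 0.
    by rewrite oppr_le0 sumr_ge0// => j _; exact: ltW.
  by move: bn; lra.
Qed.

(** Periods within [d / 4] of the times [T + d / 2] and [T] differ by an amount in [(0, d)]. *)
Lemma mixing_close_periods r : subshift_finite_type X -> walters_property r ->
  (forall x, 0 < r x) -> topologically_mixing r -> close_periods r.
Proof.
move=> Xsft wr r0 mix d d0; have [x _] := shift_space_point X.
have [T hT] := @mixing_period r (d / 4) x Xsft wr r0 ltac:(lra) mix.
have [n1 [z1 [zz1]]] := hT (T + d / 2) ltac:(lra).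
have [n2 [z2 [zz2]]] := hT T (lexx T).
rewrite !ltr_norml => /andP[? ?] /andP[? ?].
by exists n1, n2, z1, z2; split => //; apply/andP; split; lra.
Qed.

End Flow.

(** * Perturbing the roof, and continuity of the periods in it *)

Section Perturbation.
Context {R : realType} {A : finType} {X : shift_space R A}.
Implicit Types (x y z : X) (r : X -> R).

(** By transitivity some orbit leaves the cylinder of [x] and returns to it; closing it up keeps it
    in the cylinder. *)
Lemma periodic_near x (m : nat) :
  subshift_finite_type X -> transitive_shift X ->
  exists (n : nat) z, [/\ (0 < n)%N, sigmaz n%:Z z = z & agree m (\val z) (\val x)].
Proof.
move=> /close_orbit[M close] /(@connecting_orbit R A X (maxn M m) x x)[n [y [n0 yx yx']]].
have [||z zz zy] := close (maxn M m) n y _ n0; first by rewrite leq_maxl.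
  exact: agree_trans yx' (agree_sym yx).
exists n, z; split => // i im; rewrite -yx; last by rewrite (leq_trans im)// leq_maxr.
by apply: zy; lia.
Qed.

(* As [X] is infinite, some point [x] is off the orbit of the periodic point
   [p], and then a central word of [x] does not occur in [p]. *)
Lemma separated_periodic : subshift_finite_type X -> transitive_shift X ->
  infinite_set (X : set (fullshift R A)) ->
  exists (n1 n2 : nat) (p z x : X) (m : nat), [/\ (0 < n1)%N, sigmaz n1%:Z p = p,
    sigmaz n2%:Z z = z, (0 < n2)%N & agree m (\val z) (\val x) /\
    forall j : nat, ~ agree m (\val (sigmaz j%:Z p)) (\val x)].
Proof.
move=> Xsft Xtr Xinf; have [x0 _] := shift_space_point X.
have [n [p [n0 pp _]]] := periodic_near x0 0 Xsft Xtr.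
have [x xp] : exists x : X, forall j, (j < n)%N -> \val (sigmaz j%:Z p) <> \val x.
  apply: contrapT => nx; apply: Xinf.
  apply: (@sub_finite_set _ _ ((fun j : nat => \val (sigmaz j%:Z p)) @` `I_n)).
    move=> x Xx; apply: contrapT => xO; apply: nx.
    by exists (SigSub (mem_set Xx)) => j jn pjx; apply: xO; exists j.
  exact/finite_image/finite_II.
(* Each of the [n] points of the orbit differs from [x] at a coordinate [c j]; the radius [m] covers
   all of these. *)
have /choice[c hc] (j : 'I_n) :
    exists i : int, \val (sigmaz (j : nat)%:Z p) i <> \val x i.
  apply: contrapT => nc; apply: (xp j (ltn_ord j)); apply/funext => i.
  by apply: contrapT => pxi; apply: nc; exists i.
pose m := (\max_(j < n) absz (c j))%N.
have [n' [z [n'0 zz zx]]] := periodic_near x m Xsft Xtr.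
exists n, n', p, z, x, m; split => //; split => // j pjx.
pose i : 'I_n := Ordinal (ltn_pmod j n0).
apply: (hc i); rewrite -pjx; last exact: (leq_bigmax i).
have pq : sigmaz (j %/ n * n)%N%:Z p = p.
  rewrite (_ : (_ * _)%N%:Z = n%:Z *+ (j %/ n)%N) ?sigmaz_periodic//.
  by move: (j %/ n)%N => l; lia.
by rewrite [in RHS](divn_eq j n) PoszD addrC -sigmazD pq.
Qed.

Definition cylinder_indicator x (m : nat) : X -> R :=
  fun y => `[< agree m (\val y) (\val x) >]%:R.

(** The indicator depends on the coordinates in [[-m, m]] only, so with [k = m] the two Birkhoff
    sums agree term by term. *)
Lemma cylinder_indicator_walters x m : walters_property (cylinder_indicator x m).
Proof.
move=> e e0; exists m => n y z /block_eqP yz.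
rewrite big1 ?normr0// => j _; apply/eqP; rewrite subr_eq0; apply/eqP.
rewrite /cylinder_indicator !iter_sigma; congr (_ %:R); congr (nat_of_bool _).
have jn := ltn_ord j.
have yzi i : (absz i <= m)%N -> \val y (i + (j : nat)%:Z) = \val z (i + (j : nat)%:Z).
  move=> im; have := yz (absz (i + (j : nat)%:Z + m%:Z)) ltac:(lia).
  by rewrite (_ : - m%:Z + _ = i + (j : nat)%:Z)//; lia.
by apply: asbool_equiv_eq; split => h i im; rewrite -h//= /shiftz yzi.
Qed.

(** Traverse the two orbits [j] and [k] times, with [j] and [k] from the pigeonhole; the sign of the
    difference decides which orbit comes first. *)
Lemma irrational_close_periods r (n1 n2 : nat) z1 z2 :
  sigmaz n1%:Z z1 = z1 -> sigmaz n2%:Z z2 = z2 ->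
  0 < birkhoff r n1 z1 -> 0 < birkhoff r n2 z2 ->
  irrational (birkhoff r n1 z1 / birkhoff r n2 z2) -> close_periods r.
Proof.
move=> zz1 zz2 b1 b2 irr d d0.
have [j [k]] := irrational_small_combination b1 b2 d0 irr.
rewrite -!birkhoff_periodic//.
have -> : n1%:Z *+ j = (n1 * j)%N%:Z by lia.
have -> : n2%:Z *+ k = (n2 * k)%N%:Z by lia.
have per1 : sigmaz (n1 * j)%N%:Z z1 = z1.
  by rewrite (_ : _%:Z = n1%:Z *+ j) ?sigmaz_periodic//; lia.
have per2 : sigmaz (n2 * k)%N%:Z z2 = z2.
  by rewrite (_ : _%:Z = n2%:Z *+ k) ?sigmaz_periodic//; lia.
have [pos|neg] := leP 0 (birkhoff r (n1 * j)%N z1 - birkhoff r (n2 * k)%N z2).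
  by rewrite ger0_norm// => h; exists (n1 * j)%N, (n2 * k)%N, z1, z2.
by rewrite ltr0_norm// opprB => h; exists (n2 * k)%N, (n1 * j)%N, z2, z1.
Qed.

Lemma birkhoff_gt0 r (n : nat) x : walters_property r -> (forall x, 0 < r x) ->
  (0 < n)%N -> 0 < birkhoff r n x.
Proof.
move=> wr r0 n0; have [c c0 rc] := walters_pos_lbound wr r0.
by apply: lt_le_trans (birkhoff_ge n x rc); rewrite pmulrn_lgt0.
Qed.

(** The indicator [f] vanishes along the orbit of [p] but not along that of [z]. Adding [u *: f]
    thus moves the ratio of the periods by [u * c / b], which is the chosen [t]. *)
Lemma close_periods_perturbation (r : walters_fun X) (e : R) :
  subshift_finite_type X -> transitive_shift X ->
  infinite_set (X : set (fullshift R A)) -> (forall x, 0 < r x) -> 0 < e ->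
  exists s : walters_fun X, [/\ forall x, 0 < s x, `|r - s| < e & close_periods s].
Proof.
move=> Xsft Xtr Xinf r0 e0.
have [n1 [n2 [p [z [x [m [n10 pp zz n20 [zx px]]]]]]]] := separated_periodic Xsft Xtr Xinf.
pose f : walters_fun X := WaltersFun (asboolT (cylinder_indicator_walters x m)).
have bp : birkhoff f n1 p = 0.
  rewrite /birkhoff big1// => j _; rewrite iter_sigma /= /cylinder_indicator.
  by rewrite asboolF.
have bz : 1 <= birkhoff f n2 z.
  rewrite /birkhoff; case: n2 n20 {zz} => // n _; rewrite big_ord_recl/=.
  rewrite [X in X + _]/cylinder_indicator asboolT// lerDl.
  by apply: sumr_ge0 => j _; rewrite /cylinder_indicator ler0n.
have rp := birkhoff_gt0 p (walters_funP r) r0 n10.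
set a := birkhoff r n2 z; set b := birkhoff r n1 p in rp; set c := birkhoff f n2 z in bz.
have f0 : 0 < `|f| + 1 by rewrite ltr_pwDr.
(* This bound on [t] is what makes the perturbation [u *: f] smaller than [e] in norm. *)
have d0 : 0 < e / (`|f| + 1) * c / b by rewrite !mulr_gt0 ?invr_gt0//; lra.
have [t [/andP[t0 td] irr]] := @irrational_translate R (a / b) _ d0.
pose u := t * b / c.
have u0 : 0 < u by rewrite !mulr_gt0 ?invr_gt0//; lra.
have bs (n : nat) y : birkhoff (r + u *: f) n y = birkhoff r n y + u * birkhoff f n y.
  by rewrite /birkhoff mulr_sumr -big_split.
have s0 y : 0 < (r + u *: f) y.
  by apply: (@lt_le_trans _ _ (r y)) => //=; rewrite lerDl mulr_ge0 ?(ltW u0).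
exists (r + u *: f); split => //.
  rewrite opprD addNKr normrN normrZ gtr0_norm//.
  apply: (@le_lt_trans _ _ (u * (`|f| + 1))); first by rewrite ler_pM2l// lerDl.
  rewrite -ltr_pdivlMr// /u ltr_pdivrMr; last lra.
  by rewrite -ltr_pdivlMr.
apply: (irrational_close_periods zz pp).
- exact: birkhoff_gt0 (walters_funP _) s0 n20.
- exact: birkhoff_gt0 (walters_funP _) s0 n10.
rewrite !bs bp mulr0 addr0 (_ : _ / _ = a / b + t)// -/a -/b -/c /u.
by field; apply/andP; split; lra.
Qed.

Lemma eval_continuous x : continuous (fun r : walters_fun X => r x).
Proof.
move=> r; apply/(@cvgrPdist_lt _ _ _ (nbhs r) (nbhs_filter r)) => e e0.
apply/nbhs_ballP; exists e => //= s; rewrite -ball_normE /= => rs.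
apply: le_lt_trans rs; apply: le_trans (sup_norm_le_walters (r - s) x).
by rewrite mulr2n lerDl.
Qed.

(** Makes a strict inequality between periods of fixed orbits an open condition on the roof. *)
Lemma birkhoff_continuous (n : nat) x :
  continuous (fun r : walters_fun X => birkhoff r n x).
Proof.
elim: n => [|n IH].
  rewrite (_ : (fun r : walters_fun X => _) = cst 0); first exact: cst_continuous.
  by apply/funext => r; exact: birkhoff0.
rewrite (_ : (fun r : walters_fun X => _) =
    (fun r : walters_fun X => birkhoff r n x + r (sigmaz n%:Z x))).
  by move=> r; exact: (@cvgD _ _ _ (nbhs r) _ _ _ _ _ (IH r) (@eval_continuous _ r)).
by apply/funext => r; rewrite -birkhoffS -PoszD addn1.
Qed.

End Perturbation.

(* [roof_functions X] carries the subspace topology of the normed space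
   [walters_fun X]. [infinite_set] excludes the single periodic orbits, whose
   suspension flows are rotations of a circle and hence never mixing. *)
Theorem theorem3p5 (R : realType) (A : finType) (X : shift_space R A)
    (X_sft : subshift_finite_type X) (X_trans : transitive_shift X)
    (X_inf : infinite_set (X : set (fullshift R A))) :
  dense [set r : roof_functions X | topologically_mixing (\val r)] /\
  Gdelta [set r : roof_functions X | topologically_mixing (\val r)].
Proof.
have roof_pos (r : roof_functions X) : forall x, 0 < \val r x := set_valP r.
split.
  move=> O [r Or] [W oW WO]; rewrite -WO in Or *.
  have := open_nbhs_nbhs (conj oW Or); rewrite -nbhs_ballE => -[e /= e0 eW].
  have [s [s0 rs cs]] := close_periods_perturbation X_sft X_trans X_inf (roof_pos r) e0.
  exists (SigSub (mem_set (s0 : roof_functions X s))); split => /=.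
    by apply: eW; rewrite -ball_normE.
  exact: close_periods_mixing (walters_funP s) s0 cs.
pose F (k : nat) := [set r : roof_functions X |
  exists (n1 n2 : nat) (z1 z2 : X), [/\ sigmaz n1%:Z z1 = z1, sigmaz n2%:Z z2 = z2 &
    0 < birkhoff (\val r) n1 z1 - birkhoff (\val r) n2 z2 < k.+1%:R^-1]].
exists F => [k|].
  (* Being closed concerns the shift alone, so the same two orbits serve for all nearby roofs. *)
  rewrite openE => r [n1 [n2 [z1 [z2 [zz1 zz2 hr]]]]].
  pose g (s : walters_fun X) : R := birkhoff s n1 z1 - birkhoff s n2 z2.
  have cg : continuous g.
    move=> s; exact: (@cvgB _ _ _ (nbhs s) _ _ _ _ _
      (@birkhoff_continuous _ _ _ n1 z1 s) (@birkhoff_continuous _ _ _ n2 z2 s)).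
  have oI : open (g @^-1` `]0, k.+1%:R^-1[%classic).
    by apply: open_comp => [s _|]; [exact: cg|exact: interval_open].
  exists (set_val @^-1` (g @^-1` `]0, k.+1%:R^-1[%classic)); split.
  - by exists (g @^-1` `]0, k.+1%:R^-1[%classic).
  - by rewrite /= in_itv.
  - by move=> s /=; rewrite in_itv /= => hs; exists n1, n2, z1, z2.
apply/seteqP; split => [r mix k _|r Fr].
  apply: (mixing_close_periods X_sft (walters_funP _) (roof_pos r) mix).
  by rewrite invr_gt0.
apply: close_periods_mixing (walters_funP _) (roof_pos r) _ => // d d0.
(* The index is the integer part of [1 / d], so that its successor exceeds [1 / d]. *)
have [n1 [n2 [z1 [z2 [zz1 zz2 /andP[lo hi]]]]]] := Fr (Num.truncn d^-1) I.
exists n1, n2, z1, z2; split => //; rewrite lo (lt_trans hi)//.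
by rewrite invf_plt ?posrE// truncnS_gt.
Qed.
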